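(* Let $\mathcal X=\{x\in\mathbb R^n:\|x\|_2\le1\}$ and $\mathcal Z=\{z\in\mathbb R^n:\|z\|_2\le1\}$. Let $N\ge3$ and let the reference distribution be $\hat{\mathbb P}_N=\frac1N\sum_{i=1}^N\delta_{\hat z_i}$, where $\hat z_1=0$ and $\hat z_2,\dots,\hat z_N$ are distinct points with $\|\hat z_i\|_2=1$ and $\sum_{i=2}^N\hat z_i=0$. Set $\rho=1/(2N)$ and $c(z,\hat z)=\|z-\hat z\|_2$. Let $v_1,\dots,v_{n+1}\in\mathbb R^n$ be the vertices of a regular $n$-simplex centered at the origin with $\|v_k\|_2=1$ for $1\le k\le n+1$. Assume the boundary samples $\{\hat z_i\}_{i=2}^N$ and the vertices $\{v_k\}_{k=1}^{n+1}$ are disjoint, that is, $M:=\max_{2\le i\le N,\,1\le k\le n+1}\hat z_i^\top v_k<1$. Choose constants $\gamma,\epsilon$ with $M<\gamma<1$ and $0<\epsilon<\min\{1-\gamma,\gamma-M\}$. Define $$\ell_k(x,z)=\|x\|_2^2-2x^\top z+v_k^\top z-\epsilon,\quad k=1,\dots,n+1,$$ $$\ell_{n+1+k}(x,z)=\|x\|_2^2-2x^\top z+\gamma\hat z_k^\top z,\quad k=1,\dots,N,$$ and $\ell(x,z)=\max_{1\le k\le N+n+1}\ell_k(x,z)$. Then any least-favorable distribution, i.e. any maximizer of the dual DRO problem $$\max_{\mathbb Q\in\mathcal P}\min_{x\in\mathcal X}\mathbb E_{z\sim\mathbb Q}[\ell(x,z)],$$ requires a support of at least $N+n+1$ distinct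 atoms. Moreover, the unique optimal least-favorable distribution attaining this minimum support is $$\mathbb Q^\star_{\mathrm{dual}}=\frac1N\Big[\frac12\delta_0+\frac1{2(n+1)}\sum_{k=1}^{n+1}\delta_{v_k}\Big]+\frac1N\sum_{i=2}^N\delta_{\hat z_i}.$$
   Context: $\mathcal P$ is the set of Borel probability measures $\mathbb Q$ on $\mathcal Z$ with $\mathrm{OT}_c(\mathbb Q,\hat{\mathbb P}_N)\le\rho$, where $\mathrm{OT}_c(\mathbb P,\mathbb Q)=\min_\gamma\mathbb E_{(z,\hat z)\sim\gamma}[c(z,\hat z)]$ is the minimum over all couplings $\gamma$ of $\mathbb P$ and $\mathbb Q$. *)

(* Defs.v *)
From HB Require Import structures.
From mathcomp Require Import all_boot all_order all_algebra.
From mathcomp Require Import all_classical all_reals all_analysis.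

Set Implicit Arguments.
Unset Strict Implicit.
Unset Printing Implicit Defensive.

Import Order.TTheory GRing.Theory Num.Theory.
Import numFieldNormedType.Exports.

Local Open Scope classical_set_scope.
Local Open Scope ring_scope.

Section euclidean.
Context {R : realType} {n : nat}.
Implicit Types x y : 'rV[R]_n.

Definition dot x y : R := \sum_(i < n) x 0 i * y 0 i.

(* The library norm on ['rV[R]_n] is the sup norm, hence this definition. *)
Definition norm2 x : R := Num.sqrt (dot x x).

Definition dist2 x y : R := norm2 (x - y).

Definition unit_ball : set 'rV[R]_n := [set x | norm2 x <= 1].

Definition affinely_independent m (v : 'I_m -> 'rV[R]_n) : Prop :=
  forall a : 'I_m -> R,
    \sum_k a k = 0 -> \sum_k a k *: v k = 0 -> forall k, a k = 0.

Definition regular_simplex (v : 'I_n.+1 -> 'rV[R]_n) : Prop :=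
  affinely_independent v /\
  forall i j k l, i != j -> k != l -> dist2 (v i) (v j) = dist2 (v k) (v l).

Definition centered (v : 'I_n.+1 -> 'rV[R]_n) : Prop := \sum_k v k = 0.

End euclidean.

(* ['rV[R]_n] with its Borel sigma-algebra (generated by the open sets) *)
Notation borelRn R n := (g_sigma_algebraType (@open 'rV[R]_n)).

Section optimal_transport.
Context {R : realType} {n : nat}.
Local Notation E := (borelRn R n).

Definition coupling (P Q : probability E R) : set (probability (E * E)%type R) :=
  [set g : probability (E * E)%type R | (forall A : set E, measurable A -> g (A `*` setT) = P A) /\
           (forall B : set E, measurable B -> g (setT `*` B) = Q B)].

Definition OT (c : 'rV[R]_n -> 'rV[R]_n -> R) (P Q : probability E R) : \bar R :=
  ereal_inf [set 'E_g[fun p : E * E => c p.1 p.2]%E | g in coupling P Q].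

(* A Borel probability measure on [Z] is a Borel probability measure on the
   whole space giving mass 1 to [Z]. *)
Definition ambiguity_set (Z : set 'rV[R]_n) (c : 'rV[R]_n -> 'rV[R]_n -> R)
    (Phat : probability E R) (rho : R) : set (probability E R) :=
  [set Q : probability E R | Q Z = 1%E /\ (OT c Q Phat <= rho%:E)%E].

Definition dual_objective (X : set 'rV[R]_n)
    (ell : 'rV[R]_n -> 'rV[R]_n -> R) (Q : probability E R) : \bar R :=
  ereal_inf [set 'E_Q[ell x]%E | x in X].

Definition least_favorable (X : set 'rV[R]_n)
    (ell : 'rV[R]_n -> 'rV[R]_n -> R) (P : set (probability E R))
    : set (probability E R) :=
  [set Q : probability E R | P Q /\ forall Q', P Q' ->
     (dual_objective X ell Q' <= dual_objective X ell Q)%E].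

Definition supp (Q : probability E R) : set 'rV[R]_n :=
  [set z | forall U : set 'rV[R]_n, open U -> U z -> (0 < Q U)%E].

Definition atoms (Q : probability E R) : set 'rV[R]_n :=
  [set z | (0 < Q [set z])%E].

End optimal_transport.

Section discrete.
Context {R : realType} {d : measure_display} {T : measurableType d}.
Local Open Scope ereal_scope.

Lemma sum_dirac_measure (I : Type) (s : seq I) (P : pred I) (a : I -> T) :
  exists mu : {measure set T -> \bar R},
    forall A, mu A = \sum_(i <- s | P i) \d_(a i) A.
Proof.
elim: s => [|i s [mu muE]].
  by exists mzero => A; rewrite big_nil.
have [Pi|nPi] := boolP (P i); last first.
  by exists mu => A; rewrite big_cons (negbTE nPi).
exists (measure_add \d_(a i) mu) => A; rewrite big_cons Pi -muE.
exact: measure_addE.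
Qed.

End discrete.

Section reference.
Context {R : realType} {n N : nat}.
Local Notation E := (borelRn R n).
Local Open Scope ereal_scope.

Definition empirical (hN : (3 <= N)%N) (zhat : 'I_N -> 'rV[R]_n)
    (A : set E) : \bar R :=
  (N%:R^-1)%:E * \sum_(i < N) \d_(zhat i : E) A.

Section instances.
Variables (hN : (3 <= N)%N) (zhat : 'I_N -> 'rV[R]_n).

Let empirical_measure : exists mu : {measure set E -> \bar R},
  empirical hN zhat = mu.
Proof.
have [m mE] := @sum_dirac_measure R _ E _ (index_enum 'I_N) xpredT zhat.
have h : (0 <= N%:R^-1 :> R)%R by rewrite invr_ge0 ler0n.
exists (mscale (NngNum h) m); apply/funext => A.
by rewrite /empirical -mE.
Qed.

Let empirical0 : empirical hN zhat set0 = 0.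
Proof. by have [mu ->] := empirical_measure; rewrite measure0. Qed.

Let empirical_ge0 A : 0 <= empirical hN zhat A.
Proof. by have [mu ->] := empirical_measure; exact: measure_ge0. Qed.

Let empirical_sigma_additive : semi_sigma_additive (empirical hN zhat).
Proof.
by have [mu ->] := empirical_measure; exact: measure_semi_sigma_additive.
Qed.

HB.instance Definition _ := isMeasure.Build _ E R (empirical hN zhat)
  empirical0 empirical_ge0 empirical_sigma_additive.

Let empirical_setT : empirical hN zhat setT = 1.
Proof.
rewrite /empirical (eq_bigr (fun=> 1%:E)); last by move=> i _; rewrite diracT.
rewrite sumEFin sumr_const card_ord -EFinM mulVf// pnatr_eq0 -lt0n.
exact: leq_trans hN.
Qed.

HB.instance Definition _ := Measure_isProbability.Build _ E R
  (empirical hN zhat) empirical_setT.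

End instances.

(* [i : 'I_N] stands for the 1-based index [i.+1], so that [(0 < i)%N] selects
   the indices 2, ..., N. *)
Definition Qdual (hN : (3 <= N)%N) (v : 'I_n.+1 -> 'rV[R]_n)
    (zhat : 'I_N -> 'rV[R]_n) (A : set E) : \bar R :=
  (N%:R^-1)%:E * ((2^-1)%:E * \d_(0%R : E) A
                  + ((2 * n.+1%:R)^-1)%:E * \sum_(k < n.+1) \d_(v k : E) A)
  + (N%:R^-1)%:E * \sum_(i < N | (0 < i)%N) \d_(zhat i : E) A.

Section instances.
Variables (hN : (3 <= N)%N) (v : 'I_n.+1 -> 'rV[R]_n) (zhat : 'I_N -> 'rV[R]_n).

Let Qdual_measure : exists mu : {measure set E -> \bar R},
  Qdual hN v zhat = mu.
Proof.
have [m1 m1E] := @sum_dirac_measure R _ E _ (index_enum 'I_n.+1) xpredT v.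
have [m2 m2E] := @sum_dirac_measure R _ E _ (index_enum 'I_N)
  (fun i => (0 < i)%N) zhat.
have h : (0 <= N%:R^-1 :> R)%R by rewrite invr_ge0 ler0n.
have h2 : (0 <= 2^-1 :> R)%R by rewrite invr_ge0 ler0n.
have hn : (0 <= (2 * n.+1%:R)^-1 :> R)%R by rewrite invr_ge0 mulr_ge0.
exists (measure_add
  (mscale (NngNum h) (measure_add
     (mscale (NngNum h2) \d_(0%R : E)) (mscale (NngNum hn) m1)))
  (mscale (NngNum h) m2)); apply/funext => A.
rewrite /Qdual -m1E -m2E; apply/esym/(etrans (measure_addE _ _ _)).
by congr (_ + _); congr (_ * _); exact: measure_addE.
Qed.

Let Qdual0 : Qdual hN v zhat set0 = 0.
Proof. by have [mu ->] := Qdual_measure; rewrite measure0. Qed.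

Let Qdual_ge0 A : 0 <= Qdual hN v zhat A.
Proof. by have [mu ->] := Qdual_measure; exact: measure_ge0. Qed.

Let Qdual_sigma_additive : semi_sigma_additive (Qdual hN v zhat).
Proof.
by have [mu ->] := Qdual_measure; exact: measure_semi_sigma_additive.
Qed.

HB.instance Definition _ := isMeasure.Build _ E R (Qdual hN v zhat)
  Qdual0 Qdual_ge0 Qdual_sigma_additive.

Let Qdual_setT : Qdual hN v zhat setT = 1.
Proof.
have N0 : (0 < N)%N by exact: leq_trans hN.
have NR : (N%:R != 0 :> R)%R by rewrite pnatr_eq0 -lt0n.
have sumN : (1 + \sum_(i < N | (0 < i)%N) 1 = N%:R :> R)%R.
  transitivity (\sum_(i < N) 1 : R)%R; last by rewrite sumr_const card_ord.
  rewrite [RHS](bigD1 (Ordinal N0))//=; congr (_ + _)%R.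
  by apply: eq_bigl => i; rewrite -val_eqE/= lt0n.
rewrite /Qdual diracT.
under eq_bigr do rewrite diracT.
under [X in _ + _ * X]eq_bigr do rewrite diracT.
rewrite !sumEFin sumr_const card_ord mule1 -!EFinM -!EFinD.
congr EFin; rewrite -mulrDr invfM -mulrA mulVf ?pnatr_eq0// mulr1.
have -> : (2^-1 + 2^-1 = 1 :> R)%R by rewrite -{1 2}[2^-1%R]mul1r -splitr.
by rewrite sumN mulVf.
Qed.

HB.instance Definition _ := Measure_isProbability.Build _ E R
  (Qdual hN v zhat) Qdual_setT.

End instances.

End reference.

Section loss.
Context {R : realType} {n N : nat}.
Variables (v : 'I_n.+1 -> 'rV[R]_n) (zhat : 'I_N -> 'rV[R]_n).

(* The neutral element -1 does not affect the maximum: the arguments are inner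
   products of unit vectors, and there is at least one of them if N >= 2. *)
Definition max_corr : R :=
  \big[Num.max/-1]_(i < N | (0 < i)%N) \big[Num.max/-1]_(k < n.+1)
    dot (zhat i) (v k).

Variables (gamma eps : R).

Definition ell_piece (k : 'I_(n.+1 + N)) (x z : 'rV[R]_n) : R :=
  match fintype.split k with
  | inl k => norm2 x ^+ 2 - 2 * dot x z + dot (v k) z - eps
  | inr k => norm2 x ^+ 2 - 2 * dot x z + gamma * dot (zhat k) z
  end.

Definition ell (x z : 'rV[R]_n) : R :=
  \big[Num.max/ell_piece (lshift N ord0) x z]_(k < n.+1 + N) ell_piece k x z.

End loss.

(* Main.v *)
From HB Require Import structures.
Require Import Defs.
From mathcomp Require Import all_boot all_order all_algebra.
From mathcomp Require Import all_classical all_reals all_analysis.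
From mathcomp Require Import measurable_realfun.
From mathcomp Require Import lra ring.

Import Order.TTheory GRing.Theory Num.Theory.
Import numFieldNormedType.Exports.

Local Open Scope classical_set_scope.
Local Open Scope ring_scope.

(** Write [ell x z = |x|^2 - 2 x.z + phi z], so that the dual objective of [Q]
    is at most [E_Q phi] (take [x = 0]), with equality when [Q] has mean zero.
    With slope [1 - eps] and [psi_0 = 0], [psi_i = gamma] otherwise, one has
    [phi z <= (1 - eps) |z - zhat_i| + psi_i] on the unit ball, with equality
    only for [z] in [{0, v_1, ..., v_(n+1)}] when [zhat_i = 0] and only for
    [z = zhat_i] otherwise. Hence
    [E_Q phi <= (1 - eps) rho + (sum_i psi_i) / N], a bound which [Qdual]
    attains. A maximizer [Q] makes everything tight: it is concentrated on the
    [v_k] and the [zhat_i], perturbing the potential at a sample fixes its mass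
    at [1 / N], the optimal value fixes the total mass of the simplex, and the
    mean, which must vanish, makes the masses of the affinely independent [v_k]
    equal. So [Qdual] is the only least-favorable distribution, with or without
    the restriction on the support. *)

(** Serves to pick one perturbation size below finitely many slacks. Starting the minimum at [b]
    gives the cap and covers an empty family. *)
Lemma finite_gt0_lb (R : realDomainType) (I : finType) (P : pred I)
    (h : I -> R) (b : R) :
  0 < b -> (forall i, P i -> 0 < h i) ->
  exists2 a, 0 < a <= b & forall i, P i -> a <= h i.
Proof.
move=> b0 h0; exists (\big[Num.min/b]_(i | P i) h i).
  by rewrite lt_bigmin//= bigmin_le_id.
by move=> i Pi; exact: bigmin_le_cond.
Qed.

(** * Euclidean inner product, norm and distance *)

Section euclidean_facts.
Context {R : realType} {n : nat}.
Implicit Types x y z : 'rV[R]_n.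

Lemma dotC x y : dot x y = dot y x.
Proof. by apply: eq_bigr => i _; rewrite mulrC. Qed.

Lemma dotDr x y z : dot x (y + z) = dot x y + dot x z.
Proof. by rewrite /dot -big_split; apply: eq_bigr => i _; rewrite mxE mulrDr. Qed.

Lemma dotZr (a : R) x y : dot x (a *: y) = a * dot x y.
Proof. by rewrite /dot mulr_sumr; apply: eq_bigr => i _; rewrite mxE mulrCA. Qed.

Lemma dotNr x y : dot x (- y) = - dot x y.
Proof. by rewrite -scaleN1r dotZr mulN1r. Qed.

Lemma dotBr x y z : dot x (y - z) = dot x y - dot x z.
Proof. by rewrite dotDr dotNr. Qed.

Lemma dot0r x : dot x 0 = 0.
Proof. by rewrite /dot big1 // => i _; rewrite mxE mulr0. Qed.

Lemma dot_sumr (I : finType) (P : pred I) (y : I -> 'rV[R]_n) x :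
  dot x (\sum_(i | P i) y i) = \sum_(i | P i) dot x (y i).
Proof.
by elim/big_rec2: _ => [|i a b _ <-]; rewrite ?dot0r// dotDr.
Qed.

Lemma dot_ge0 x : 0 <= dot x x.
Proof. by apply: sumr_ge0 => i _; rewrite -expr2 sqr_ge0. Qed.

Lemma dot_eq0 x : dot x x = 0 -> x = 0.
Proof.
move=> /eqP; rewrite psumr_eq0 => [/allP x0|i _]; last by rewrite -expr2 sqr_ge0.
apply/rowP => i; rewrite mxE; apply/eqP.
by have := x0 i (mem_index_enum i); rewrite /= mulf_eq0 orbb.
Qed.

Lemma norm2_ge0 x : 0 <= norm2 x.
Proof. exact: sqrtr_ge0. Qed.

Lemma norm2_sqr x : norm2 x ^+ 2 = dot x x.
Proof. by rewrite sqr_sqrtr// dot_ge0. Qed.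

Lemma norm2_0 : norm2 (0 : 'rV[R]_n) = 0.
Proof. by rewrite /norm2 dot0r sqrtr0. Qed.

Lemma norm2_eq0 x : norm2 x = 0 -> x = 0.
Proof. by move=> x0; apply: dot_eq0; rewrite -norm2_sqr x0 expr0n. Qed.

Lemma norm2B_sqr x y :
  norm2 (x - y) ^+ 2 = norm2 x ^+ 2 - 2 * dot x y + norm2 y ^+ 2.
Proof.
rewrite !norm2_sqr dotBr dotC dotBr [dot (x - y) y]dotC dotBr (dotC y x).
ring.
Qed.

Lemma norm2Z (a : R) x : 0 <= a -> norm2 (a *: x) = a * norm2 x.
Proof.
by move=> a0; rewrite /norm2 dotZr dotC dotZr mulrA -expr2 sqrtrM ?sqr_ge0//
  sqrtr_sqr ger0_norm.
Qed.

(** Cauchy-Schwarz: for nonzero vectors the squared norm of [norm2 y *: x - norm2 x *: y] is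
    [2 |x| |y| (|x| |y| - x.y)], and the factor [|x| |y|] divides out. *)
Lemma dot_le_norm2 x y : dot x y <= norm2 x * norm2 y.
Proof.
have [x0|x0] := eqVneq (norm2 x) 0.
  by rewrite (norm2_eq0 x x0) dotC dot0r norm2_0 mul0r.
have [y0|y0] := eqVneq (norm2 y) 0.
  by rewrite (norm2_eq0 y y0) dot0r norm2_0 mulr0.
have xp : 0 < norm2 x by rewrite lt_def x0 norm2_ge0.
have yp : 0 < norm2 y by rewrite lt_def y0 norm2_ge0.
have := sqr_ge0 (norm2 (norm2 y *: x - norm2 x *: y)).
rewrite norm2B_sqr !norm2Z ?norm2_ge0// dotZr dotC dotZr dotC.
have xyp : 0 < norm2 x * norm2 y by rewrite mulr_gt0.
move=> h; rewrite -(ler_pM2l xyp); nra.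
Qed.

Lemma dist2_ge0 x y : 0 <= dist2 x y.
Proof. exact: norm2_ge0. Qed.

Lemma dist2xx x : dist2 x x = 0.
Proof. by rewrite /dist2 subrr norm2_0. Qed.

Lemma dist2x0 x : dist2 x 0 = norm2 x.
Proof. by rewrite /dist2 subr0. Qed.

Lemma dist2_eq0 x y : dist2 x y = 0 -> x = y.
Proof. by move=> /norm2_eq0/eqP; rewrite subr_eq0 => /eqP. Qed.

Lemma dist2_unit_ball x y : norm2 x <= 1 -> norm2 y <= 1 -> dist2 x y <= 2.
Proof.
move=> x1 y1; rewrite -(@ler_pXn2r _ 2)// ?nnegrE ?dist2_ge0//.
have /= := dot_le_norm2 x (- y); rewrite dotNr.
have -> : norm2 (- y) = norm2 y.
  by rewrite /norm2 dotNr dotC dotNr opprK.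
rewrite /dist2 norm2B_sqr => h.
have := norm2_ge0 x; have := norm2_ge0 y; nra.
Qed.

(** Equality case of Cauchy-Schwarz: here [|x - y|^2 = 2 - 2 x.y]. *)
Lemma unit_dot_ge1 x y : norm2 x = 1 -> norm2 y = 1 -> 1 <= dot x y -> x = y.
Proof.
move=> x1 y1 xy; apply: dist2_eq0; apply/eqP; rewrite -sqrf_eq0 /dist2.
rewrite eq_le sqr_ge0 andbT norm2B_sqr x1 y1; lra.
Qed.

End euclidean_facts.

(** * The loss: dependence on [x] and pieces at [x = 0] *)

Section loss_facts.
Context {R : realType} {n N : nat}.
Variables (v : 'I_n.+1 -> 'rV[R]_n) (zhat : 'I_N -> 'rV[R]_n).
Variables (gamma eps : R).
Local Notation ell := (ell v zhat gamma eps).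
Implicit Types x z : 'rV[R]_n.

Lemma ell_pieceE k x z : ell_piece v zhat gamma eps k x z =
  norm2 x ^+ 2 - 2 * dot x z + ell_piece v zhat gamma eps k 0 z.
Proof.
rewrite /ell_piece norm2_0 [dot 0 z]dotC dot0r.
by case: fintype.split => j; ring.
Qed.

Lemma ell_ge_piece k x z : ell_piece v zhat gamma eps k x z <= ell x z.
Proof. exact: le_bigmax. Qed.

Lemma ell_attained x z : exists k, ell x z = ell_piece v zhat gamma eps k x z.
Proof.
rewrite /Defs.ell; elim/big_ind: _ => [|a b [i ->] [j ->]|i _].
- by exists (lshift N ord0).
- by case: (leP (ell_piece v zhat gamma eps i x z)); [exists j|exists i].
- by exists i.
Qed.

(** The term [|x|^2 - 2 x.z] is common to all pieces, so it comes out of the maximum. *)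
Lemma ellE x z : ell x z = norm2 x ^+ 2 - 2 * dot x z + ell 0 z.
Proof.
apply/eqP; rewrite eq_le; apply/andP; split.
  by have [k ->] := ell_attained x z; rewrite ell_pieceE lerD2l ell_ge_piece.
by have [k ->] := ell_attained 0 z; rewrite -ell_pieceE ell_ge_piece.
Qed.

Lemma ell0_attained z : (exists k, ell 0 z = dot (v k) z - eps) \/
  (exists i, ell 0 z = gamma * dot (zhat i) z).
Proof.
have [k ->] := ell_attained 0 z; rewrite /ell_piece norm2_0 [dot 0 z]dotC dot0r.
by case: fintype.split => j; [left|right]; exists j; ring.
Qed.

Lemma ell0_ge_simplex k z : dot (v k) z - eps <= ell 0 z.
Proof.
apply: le_trans (ell_ge_piece (lshift N k) 0 z).
rewrite /ell_piece norm2_0 [dot 0 z]dotC dot0r.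
by rewrite (_ : fintype.split _ = inl k) ?(unsplitK (inl k))//; lra.
Qed.

Lemma ell0_ge_sample i z : gamma * dot (zhat i) z <= ell 0 z.
Proof.
apply: le_trans (ell_ge_piece (rshift n.+1 i) 0 z).
rewrite /ell_piece norm2_0 [dot 0 z]dotC dot0r.
by rewrite (_ : fintype.split _ = inr i) ?(unsplitK (inr i))//; lra.
Qed.

Lemma max_corr_ge (i : 'I_N) k : (0 < i)%N -> dot (zhat i) (v k) <= max_corr v zhat.
Proof.
move=> i0; apply: le_trans (le_bigmax_cond _ _ i0).
exact: le_bigmax.
Qed.

End loss_facts.

(** * Borel measurability *)

Section borel.
Context {R : realType} {n : nat}.
Local Notation E := (borelRn R n).

Lemma open_borel (U : set 'rV[R]_n) : open U -> measurable (U : set E).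
Proof. exact: sub_sigma_algebra. Qed.

Lemma closed_borel (U : set 'rV[R]_n) : closed U -> measurable (U : set E).
Proof. by move=> /closed_openC/open_borel/measurableC; rewrite setCK. Qed.

Lemma finite_set_closed_rV (A : set 'rV[R]_n) : finite_set A -> closed A.
Proof.
move: A; apply/accessible_finite_set_closed.
by apply: hausdorff_accessible; exact: norm_hausdorff.
Qed.

Lemma finite_set_borel (A : set 'rV[R]_n) : finite_set A -> measurable (A : set E).
Proof. by move=> /finite_set_closed_rV/closed_borel. Qed.

Lemma set1_borel (z : 'rV[R]_n) : measurable ([set z] : set E).
Proof. by apply: finite_set_borel; exact: finite_set1. Qed.

Lemma continuous_borel_measurable_fun (f : 'rV[R]_n -> R) :
  continuous f -> measurable_fun setT (f : E -> R).
Proof.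
move=> /continuousP cf; apply: (measurability _ (RGenOpens.measurableE R)).
move=> _ [_ [a [b ->] <-]]; rewrite setTI; apply: open_borel.
exact/cf/interval_open.
Qed.

Lemma measurable_coord i : measurable_fun setT ((fun z => z 0 i) : E -> R).
Proof. by apply: continuous_borel_measurable_fun; exact: coord_continuous. Qed.

Section pointwise.
Context {d : measure_display} {T : measurableType d}.

Lemma measurable_fun_dot (f g : T -> E) : measurable_fun setT f ->
  measurable_fun setT g -> measurable_fun setT (fun t => dot (f t) (g t)).
Proof.
move=> mf mg; apply: measurable_sum => i; apply: measurable_funM.
  exact: (measurableT_comp (measurable_coord i) mf).
exact: (measurableT_comp (measurable_coord i) mg).
Qed.

Lemma measurable_fun_dist2 (f g : T -> E) : measurable_fun setT f ->
  measurable_fun setT g -> measurable_fun setT (fun t => dist2 (f t) (g t)).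
Proof.
move=> mf mg.
have msqrt : measurable_fun setT (Num.sqrt : R -> R).
  by apply: continuous_measurable_fun; exact: sqrt_continuous.
apply: (measurableT_comp msqrt); apply: measurable_sum => i.
have mi : measurable_fun setT (fun t => (f t - g t) 0 i : R).
  under eq_fun do rewrite !mxE.
  apply: measurable_funB.
    exact: (measurableT_comp (measurable_coord i) mf).
  exact: (measurableT_comp (measurable_coord i) mg).
exact: measurable_funM.
Qed.

Lemma measurable_fun_bigmax (I : Type) (s : seq I) (P : pred I)
    (f : I -> T -> R) (g : T -> R) : measurable_fun setT g ->
  (forall i, measurable_fun setT (f i)) ->
  measurable_fun setT (fun t => \big[Num.max/g t]_(i <- s | P i) f i t).
Proof.
move=> mg mf; elim: s => [|i s ih]; first by under eq_fun do rewrite big_nil.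
under eq_fun do rewrite big_cons.
by case: (P i) => //; exact: measurable_maxr.
Qed.

Lemma measurable_fun_bigmin (I : Type) (s : seq I) (P : pred I)
    (f : I -> T -> R) (g : T -> R) : measurable_fun setT g ->
  (forall i, measurable_fun setT (f i)) ->
  measurable_fun setT (fun t => \big[Num.min/g t]_(i <- s | P i) f i t).
Proof.
move=> mg mf; elim: s => [|i s ih]; first by under eq_fun do rewrite big_nil.
under eq_fun do rewrite big_cons.
by case: (P i) => //; exact: measurable_minr.
Qed.

End pointwise.

Lemma measurable_ell (N : nat) v (zhat : 'I_N -> 'rV[R]_n) gamma eps x :
  measurable_fun setT (ell v zhat gamma eps x : E -> R).
Proof.
have mdot a : measurable_fun setT (fun z : E => dot a z).
  exact: measurable_fun_dot.
have mp k : measurable_fun setT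
    (fun z : E => ell_piece v zhat gamma eps k x z).
  rewrite /ell_piece; case: (fintype.split k) => i.
    apply: measurable_funB => //; apply: measurable_funD => //.
    by apply: measurable_funB => //; exact: measurable_funM.
  apply: measurable_funD; last exact: measurable_funM.
  by apply: measurable_funB => //; exact: measurable_funM.
exact: measurable_fun_bigmax.
Qed.

Lemma unit_ball_borel : measurable (unit_ball : set E).
Proof.
have m : measurable_fun setT (fun z : E => dist2 z 0).
  exact: measurable_fun_dist2.
rewrite (_ : unit_ball = setT `&` (fun z : E => dist2 z 0) @^-1` `]-oo, 1]).
  by apply: m => //; exact: measurable_itv.
by rewrite setTI; apply/seteqP; split => z; rewrite /= in_itv/= dist2x0.
Qed.

Lemma supp_eq (Q Q' : probability E R) :
  (forall A : set E, measurable A -> Q A = Q' A) -> supp Q = supp Q'.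
Proof.
move=> QQ; apply/seteqP; split => z zs U oU Uz.
  by rewrite -[ltRHS]QQ; [exact: zs|exact: open_borel].
by rewrite [ltRHS]QQ; [exact: zs|exact: open_borel].
Qed.

End borel.

(** * Probabilities concentrated on finitely many points *)

Section concentrated.
Context {R : realType} {d : measure_display} {T : measurableType d}.
Variables (P : probability T R).
Local Open Scope ereal_scope.

Lemma probability1_setC (A : set T) : measurable A -> P A = 1 -> P (~` A) = 0.
Proof. by move=> mA PA; rewrite probability_setC// PA subee. Qed.

Context {I : finType} {s : I -> T}.
Hypothesis s_inj : injective s.
Hypothesis s_meas : forall i, measurable [set s i].
Hypothesis P_range : P (range s) = 1.

Lemma fin_range_measurable : measurable (range s).
Proof.
rewrite (_ : range s = \big[setU/set0]_i [set s i]).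
  by apply: bigsetU_measurable => i _.
apply/seteqP; split => [_ [i _ <-]|x].
  by rewrite -bigcup_seq; exists i => //=; rewrite mem_index_enum.
by rewrite -bigcup_seq => -[i _ ->]; exists i.
Qed.

(** Off a null set [f] agrees with a combination of indicators of the points [s i]; as [s] is
    injective, a single term survives at each point. *)
Lemma ge0_integral_concentrated (f : T -> \bar R) : measurable_fun setT f ->
  (forall x, 0 <= f x) -> \int[P]_x f x = \sum_i f (s i) * P [set s i].
Proof.
move=> mf f0.
transitivity (\int[P]_x \sum_i f (s i) * (\1_[set s i] x)%:E).
  apply: ge0_ae_eq_integral => //.
  - apply: emeasurable_sum => i.
    apply: emeasurable_funM => //; apply/measurable_EFinP.
    exact: measurable_indic.
  - by move=> x _; apply: sume_ge0 => i _; rewrite mule_ge0// lee_fin.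
  - exists (~` range s); split.
    + exact/measurableC/fin_range_measurable.
    + by apply: probability1_setC; [exact: fin_range_measurable|].
    + move=> x /= h [i _ six]; apply: h => _; rewrite -six.
      rewrite (bigD1 i)//= indicE mem_set// mule1 big1 ?adde0// => j ji.
      rewrite indicE memNset ?mule0//= => /s_inj/esym/eqP.
      exact/negP.
rewrite ge0_integral_sum//.
- apply: eq_bigr => i _.
  rewrite ge0_integralZl ?integral_indic ?setIT//.
  by apply/measurable_EFinP; exact: measurable_indic.
- move=> i; apply: emeasurable_funM => //; apply/measurable_EFinP.
  exact: measurable_indic.
- by move=> i x _; rewrite mule_ge0// lee_fin.
Qed.

(** Positive and negative parts each integrate to a finite real, so their difference is
    legitimate. *)
Lemma integral_concentrated (f : T -> R) : measurable_fun setT f ->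
  \int[P]_x (f x)%:E = (\sum_i f (s i) * fine (P [set s i]))%:E.
Proof.
move=> mf; have mfE : measurable_fun setT (EFin \o f) by exact/measurable_EFinP.
have PE i : P [set s i] = (fine (P [set s i]))%:E.
  by rewrite fineK// fin_num_measure.
have max0 (g : T -> R) : measurable_fun setT g ->
    \int[P]_x (Num.max (g x) 0)%:E =
    (\sum_i Num.max (g (s i)) 0 * fine (P [set s i]))%:E.
  move=> mg; rewrite ge0_integral_concentrated.
  - by rewrite -sumEFin; apply: eq_bigr => i _; rewrite PE.
  - by apply/measurable_EFinP; exact: measurable_maxr.
  - by move=> x; rewrite lee_fin le_max lexx orbT.
rewrite integralE.
have -> : \int[P]_x (fun x => (f x)%:E)^\+ x = \int[P]_x (Num.max (f x) 0)%:E.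
  by apply: eq_integral => x _; rewrite funeposE EFin_max.
have -> : \int[P]_x (fun x => (f x)%:E)^\- x = \int[P]_x (Num.max (- f x) 0)%:E.
  by apply: eq_integral => x _; rewrite funenegE EFin_max EFinN.
rewrite !max0//; last exact: measurableT_comp.
rewrite -EFinB -sumrB; congr EFin; apply: eq_bigr => i _.
rewrite -mulrBl; congr (_ * _)%R.
by case: (leP (f (s i)) 0)%R; case: (leP (- f (s i)) 0)%R; lra.
Qed.

End concentrated.

(** * Weak duality for transport to the empirical measure *)

Section weak_duality.
Context {R : realType} {n N : nat}.
Local Notation E := (borelRn R n).
Variables (hN : (3 <= N)%N) (zhat : 'I_N -> 'rV[R]_n).
Hypothesis zhat_inj : injective zhat.

Lemma N_neq0 : N%:R != 0 :> R.
Proof. by rewrite pnatr_eq0 -lt0n; apply: leq_trans hN. Qed.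

Lemma empirical_set1 j : empirical hN zhat [set zhat j] = (N%:R^-1)%:E.
Proof.
rewrite /empirical (bigD1 j)//= diracE mem_set// big1 ?adde0 ?mule1//.
move=> i ij; rewrite diracE memNset//= => /zhat_inj/eqP.
exact/negP.
Qed.

Lemma empirical_range : empirical hN zhat (range zhat) = 1%E.
Proof.
rewrite /empirical (eq_bigr (fun=> 1%:E)); last first.
  by move=> i _; rewrite diracE mem_set//; exists i.
by rewrite sumEFin sumr_const card_ord -EFinM mulVf// N_neq0.
Qed.

Lemma integral_coupling_fst (P Q : probability E R) g (f : E -> \bar R) :
  coupling P Q g -> measurable_fun setT f -> (forall z, 0 <= f z)%E ->
  (\int[g]_p f p.1 = \int[P]_z f z)%E.
Proof.
move=> [gP _] mf f0.
transitivity (\int[pushforward g fst]_z f z)%E.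
  by rewrite ge0_integral_pushforward.
apply: eq_measure_integral => A mA _; apply: etrans (gP A mA).
by rewrite /pushforward setXT.
Qed.

Lemma integral_coupling_snd (P Q : probability E R) g (f : E -> \bar R) :
  coupling P Q g -> measurable_fun setT f -> (forall z, 0 <= f z)%E ->
  (\int[g]_p f p.2 = \int[Q]_z f z)%E.
Proof.
move=> [_ gQ] mf f0.
transitivity (\int[pushforward g snd]_z f z)%E.
  by rewrite ge0_integral_pushforward.
apply: eq_measure_integral => A mA _; apply: etrans (gQ A mA).
by rewrite /pushforward setTX.
Qed.

Variables (Q : probability E R) (S : set E).
Hypotheses (mS : measurable S) (QS : Q S = 1%E).
Variables (lam : R) (psi : 'I_N -> R) (f : E -> R).
Hypotheses (lam0 : 0 <= lam) (psi0 : forall i, 0 <= psi i).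
Hypotheses (mf : measurable_fun setT f) (f0 : forall z, 0 <= f z).
Hypothesis f_le : forall z i, S z -> f z <= lam * dist2 z (zhat i) + psi i.

(** Integrate [f z <= lam * dist2 z y + Psi y] against [g]: the left side sees only the first
    marginal, [Psi] only the second, and the bound holds wherever [z] is in [S] and [y] is a
    sample. *)
Lemma coupling_duality g : coupling Q (empirical hN zhat) g ->
  (\int[Q]_z (f z)%:E <= lam%:E * 'E_g[fun p : E * E => dist2 p.1 p.2]
    + (N%:R^-1 * \sum_i psi i)%:E)%E.
Proof.
move=> gc; have [gQ gP] := gc.
(* [psi] extended by zero off the samples, as a measurable function on the whole space. *)
pose Psi (z : E) : R := \sum_i psi i * \1_[set zhat i] z.
have mrange : measurable (range zhat : set E).
  by apply: fin_range_measurable => i; exact: set1_borel.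
have mPsi : measurable_fun setT Psi.
  apply: measurable_sum => i; apply: measurable_funM => //.
  by apply: measurable_indic; exact: set1_borel.
have Psi0 z : 0 <= Psi z by apply: sumr_ge0 => i _; rewrite mulr_ge0.
have PsiE i : Psi (zhat i) = psi i.
  rewrite /Psi (bigD1 i)//= indicE mem_set// mulr1 big1 ?addr0// => j ji.
  by rewrite indicE memNset ?mulr0//= => /zhat_inj/esym/eqP; exact/negP.
have mdist : measurable_fun setT (fun p : E * E => dist2 p.1 p.2).
  exact: measurable_fun_dist2.
rewrite -(integral_coupling_fst _ _ _ (EFin \o f) gc); last 2 first.
  exact/measurable_EFinP.
  by move=> z; rewrite lee_fin.
have -> : ((N%:R^-1 * \sum_i psi i)%:E = \int[g]_p (Psi p.2)%:E)%E.
  rewrite (integral_coupling_snd _ _ _ (EFin \o Psi) gc); last 2 first.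
    exact/measurable_EFinP.
    by move=> z; rewrite lee_fin.
  rewrite (@integral_concentrated _ _ E _ _ zhat)//; last 2 first.
    by move=> i; exact: set1_borel.
    exact: empirical_range.
  rewrite mulr_sumr; congr EFin; apply: eq_bigr => i _.
  rewrite PsiE mulrC; congr (_ * _).
  exact/esym/(congr1 fine (empirical_set1 i)).
rewrite unlock -ge0_integralZl_EFin//; last 2 first.
  by move=> p _; rewrite lee_fin dist2_ge0.
  exact/measurable_EFinP.
rewrite -ge0_integralD//; last 4 first.
  by move=> p _; rewrite -EFinM lee_fin mulr_ge0// dist2_ge0.
  by apply/measurable_EFinP; exact: measurable_funM.
  by move=> p _; rewrite lee_fin.
  by apply/measurable_EFinP; exact: measurableT_comp.
apply: ae_ge0_le_integral => //.
- by move=> p _; rewrite lee_fin.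
- by apply/measurable_EFinP; exact: measurableT_comp.
- by move=> p _; rewrite -EFinM -EFinD lee_fin addr_ge0// mulr_ge0// dist2_ge0.
- apply/measurable_EFinP; apply: measurable_funD; first exact: measurable_funM.
  exact: measurableT_comp.
(* The exceptional set is a union of two cylinders, each null because the corresponding marginal
   gives no mass to its base. *)
exists ((~` S `*` setT) `|` (setT `*` ~` (range zhat : set E))); split.
- by apply: measurableU; apply: measurableX => //; exact: measurableC.
- apply/eqP; rewrite eq_le measure_ge0 andbT.
  apply: (le_trans (measureU2 _ _ _)).
  + by apply: measurableX => //; exact: measurableC.
  + by apply: measurableX => //; exact: measurableC.
  + rewrite [X in (X + _)%E]gQ ?[X in (_ + X)%E]gP; try exact: measurableC.
    by rewrite !probability1_setC ?adde0//; exact: empirical_range.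
- move=> [z y] /= h; apply: contrapT => /not_orP[]/not_andP[]; last by [].
  move=> /contrapT Sz /not_andP[//|/contrapT[i _ yi]].
  by apply: h => _; rewrite -EFinM -EFinD lee_fin -yi PsiE f_le.
Qed.

Lemma weak_duality rho : (OT dist2 Q (empirical hN zhat) <= rho%:E)%E ->
  (\int[Q]_z (f z)%:E <= (lam * rho + N%:R^-1 * \sum_i psi i)%:E)%E.
Proof.
move=> OTle; apply/lee_addgt0Pr => e e0.
have l1 : 0 < lam + 1 by rewrite ltr_wpDl.
(* A coupling within [e / (lam + 1)] of the bound suffices: multiplied by [lam], this error stays
   below [e], and the quotient makes sense for [lam = 0] too. *)
have d0 : 0 < e / (lam + 1) by rewrite divr_gt0.
have [] := @ereal_inf_lt _ _ (rho + e / (lam + 1))%:E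
  (le_lt_trans OTle _); first by rewrite lte_fin ltrDl.
move=> _ [g gc <-] glt; apply: (le_trans (coupling_duality g gc)).
rewrite -EFinD addrAC EFinD leeD2r//.
have cost_le := lee_wpmul2l (lam0 : (0 <= lam%:E)%E) (ltW glt).
apply: (le_trans cost_le); rewrite -EFinM lee_fin mulrDr lerD2l.
by rewrite mulrA mulrAC ler_piMl ?(ltW e0)// ler_pdivrMr// mul1r lerDl.
Qed.

End weak_duality.

(** * The instance: samples, vertices and dual potentials *)

Section instance.
Context {R : realType} {n N : nat}.
Variables (hN : (3 <= N)%N) (zhat : 'I_N -> 'rV[R]_n).
Hypothesis zhat_first : forall i : 'I_N, i = 0%N :> nat -> zhat i = 0.
Hypothesis zhat_distinct : forall i j : 'I_N, (0 < i)%N -> (0 < j)%N ->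
  zhat i = zhat j -> i = j.
Hypothesis zhat_unit : forall i : 'I_N, (0 < i)%N -> norm2 (zhat i) = 1.
Hypothesis zhat_sum : \sum_(i < N | (0 < i)%N) zhat i = 0.
Variable v : 'I_n.+1 -> 'rV[R]_n.
Hypothesis v_affine : affinely_independent v.
Hypothesis v_centered : centered v.
Hypothesis v_unit : forall k, norm2 (v k) = 1.
Hypothesis M_lt1 : max_corr v zhat < 1.
Variables (gamma eps : R).
Hypothesis gamma_gt : max_corr v zhat < gamma.
Hypothesis eps_gt0 : 0 < eps.
Hypothesis eps_lt : eps < Num.min (1 - gamma) (gamma - max_corr v zhat).

Local Notation phi := (ell v zhat gamma eps 0).

(** Potential of the samples in the transport dual; it agrees with [phi] at each sample
    ([phi_zhat]). *)
Definition psi (i : 'I_N) : R := if (0 < i)%N then gamma else 0.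

(** Indexes all candidate atoms; the origin is among the samples. *)
Definition pt (t : 'I_n.+1 + 'I_N) : 'rV[R]_n :=
  match t with inl k => v k | inr i => zhat i end.

Definition origin : 'I_N := Ordinal (leq_trans (isT : (0 < 3)%N) hN).

Lemma zhat_origin : zhat origin = 0.
Proof. exact: zhat_first. Qed.

Lemma neq_origin (i : 'I_N) : (i != origin) = (0 < i)%N.
Proof. by rewrite -val_eqE/= lt0n. Qed.

Lemma zhat_ball i : norm2 (zhat i) <= 1.
Proof.
case: (posnP i) => [/zhat_first ->|/zhat_unit ->//].
by rewrite norm2_0.
Qed.

(** The boundary samples sum to zero, so their products with a vertex cannot all be negative; hence
    [max_corr v zhat >= 0]. *)
Lemma gamma_gt0 : 0 < gamma.
Proof.
apply: le_lt_trans gamma_gt; rewrite leNgt; apply/negP => M0.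
have i1 : (1 < N)%N by apply: leq_trans hN.
have : \sum_(i < N | (0 < i)%N) dot (v ord0) (zhat i) < 0.
  rewrite (bigD1 (Ordinal i1))//=.
  rewrite -[ltRHS]addr0; apply: ltr_leD.
    by rewrite dotC; apply: le_lt_trans M0; exact: max_corr_ge.
  apply: sumr_le0 => i /andP[i0 _]; rewrite dotC.
  by apply/ltW/le_lt_trans/M0; exact: max_corr_ge.
by rewrite -dot_sumr zhat_sum dot0r ltxx.
Qed.

Lemma eps_ltP : eps < 1 - gamma /\ eps < gamma - max_corr v zhat.
Proof. by move: eps_lt; rewrite lt_min => /andP[]. Qed.

(** A vertex differs from the origin by its norm, and from a boundary sample because its product
    with itself is 1 while [max_corr v zhat < 1]. *)
Lemma pt_inj : injective pt.
Proof.
have vz k i : v k <> zhat i.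
  move=> vzE; case: (posnP i) => i0.
    by have := v_unit k; rewrite vzE zhat_first// norm2_0 => /eqP; rewrite eq_sym oner_eq0.
  have := max_corr_ge v zhat i k i0.
  rewrite -vzE -norm2_sqr v_unit expr1n => M1.
  by move: (le_lt_trans M1 M_lt1); rewrite ltxx.
case=> [k|i] [l|j] //=.
- move=> vkl; congr inl; apply/eqP/negP => /negP kl.
  (* Equal vertices would give a nontrivial affine relation, with coefficients 1 at [k] and -1 at
     [l]. *)
  have := v_affine (fun m => (m == k)%:R - (m == l)%:R).
  have deltaE (W : lmodType R) (f : 'I_n.+1 -> W) m :
      \sum_i (i == m)%:R *: f i = f m.
    rewrite (bigD1 m)//= eqxx scale1r big1 ?addr0// => i /negbTE ->.
    by rewrite scale0r.
  have d1 m : \sum_i (i == m)%:R = 1 :> R.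
    by rewrite (bigD1 m)//= eqxx big1 ?addr0// => i /negbTE ->.
  case/(_ _ _ k)/Wrap => [| |].
  + by rewrite sumrB !d1 subrr.
  + under eq_bigr do rewrite scalerBl.
    by rewrite sumrB !deltaE vkl subrr.
  + by move=> []/eqP; rewrite eqxx (negbTE kl) subr0 oner_eq0.
- by move=> /vz.
- by move=> /esym/vz.
- have [-> ij|i0] := eqVneq i origin; have [->//|j0] := eqVneq j origin.
  + move: ij; rewrite zhat_origin => /esym zj.
    have := zhat_unit j; rewrite -neq_origin j0 zj norm2_0 => /(_ isT)/eqP.
    by rewrite eq_sym oner_eq0.
  + rewrite zhat_origin => zj.
    have := zhat_unit i; rewrite -neq_origin i0 zj norm2_0 => /(_ isT)/eqP.
    by rewrite eq_sym oner_eq0.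
  + by move=> /zhat_distinct ->//; rewrite -neq_origin.
Qed.

(** Equality cases of the dual constraint. Sample pieces have slope at most [gamma < 1 - eps], so
    they cannot catch up away from the sample. Simplex pieces have slope 1: from the origin they
    catch up only on the sphere, from a boundary sample never. *)
Lemma tight z j : norm2 z <= 1 ->
  (1 - eps) * dist2 z (zhat j) + psi j <= phi z ->
  (j = origin /\ (z = 0 \/ exists k, z = v k)) \/ ((0 < j)%N /\ z = zhat j).
Proof.
move=> z1; have [e1 e2] := eps_ltP; have g0 := gamma_gt0; have e0 := eps_gt0.
have zz := norm2_ge0 z; rewrite /psi.
have [->|] := eqVneq j origin; [|rewrite neq_origin => j0].
  rewrite /= addr0 zhat_origin dist2x0 => h; left; split => //; move: h.
  have [[k ->]|[i ->]] := ell0_attained v zhat gamma eps z => h.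
    have := dot_le_norm2 (v k) z; rewrite v_unit mul1r => h1.
    (* [(1 - eps) |z| <= v_k.z - eps <= |z| - eps] leaves [eps <= eps * |z|]. *)
    have z1E : norm2 z = 1.
      apply/eqP; rewrite eq_le z1 -subr_ge0 -(pmulr_rge0 _ eps_gt0)/=; lra.
    right; exists k; apply/esym/unit_dot_ge1 => //; nra.
  have := dot_le_norm2 (zhat i) z => h1.
  have h2 := zhat_ball i.
  have h3 : dot (zhat i) z <= norm2 z by have := norm2_ge0 (zhat i); nra.
  left; apply: norm2_eq0; apply/eqP; rewrite eq_le zz andbT.
  have c : 0 < 1 - eps - gamma by lra.
  rewrite -(pmulr_rle0 _ c); nra.
rewrite j0 => h; right; split => //; move: h.
have d0 := dist2_ge0 z (zhat j); have d2 := dist2_unit_ball _ _ z1 (zhat_ball j).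
have [[k ->]|[i ->]] := ell0_attained v zhat gamma eps z => h.
  have := dot_le_norm2 (v k) (z - zhat j); rewrite v_unit mul1r dotBr -/(dist2 _ _).
  have := max_corr_ge v zhat j k j0; rewrite dotC => h1 h2.
  (* With [M = max_corr v zhat], a simplex piece needs [gamma - M + eps <= eps * dist2 z (zhat j)];
     the diameter 2 of the ball bounds the right side by [2 * eps], against [eps < gamma - M]. *)
  have h3 : 0 <= eps * (2 - dist2 z (zhat j)).
    by apply: mulr_ge0; [exact: ltW|lra].
  exfalso; lra.
have := dot_le_norm2 (zhat i) (z - zhat j); rewrite dotBr -/(dist2 _ _).
have := dot_le_norm2 (zhat i) (zhat j); rewrite (zhat_unit j j0) mulr1.
have := zhat_ball i; have := norm2_ge0 (zhat i) => h1 h2 h3 h4.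
have h5 : dot (zhat i) z <= 1 + dist2 z (zhat j) by nra.
apply: dist2_eq0; apply/eqP; rewrite eq_le d0 andbT.
(* What remains is [(1 - eps - gamma) * d <= 0], with [d] the distance to [zhat j]. *)
have c : 0 < 1 - eps - gamma by lra.
rewrite -(pmulr_rle0 _ c); nra.
Qed.

(** A strict violation would satisfy the hypothesis of [tight], so only the points listed there need
    checking, piece by piece. *)
Lemma phi_le z j : norm2 z <= 1 -> phi z <= (1 - eps) * dist2 z (zhat j) + psi j.
Proof.
move=> z1; rewrite leNgt; apply/negP => h.
have /(_ (ltW h)) := tight z j z1.
have [e1 e2] := eps_ltP; have g0 := gamma_gt0; have e0 := eps_gt0.
move: h; rewrite /psi => h [[jE [zE|[k zE]]]|[j0 zE]]; move: h.
- rewrite jE zE zhat_origin dist2xx/=.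
  have [[k ->]|[i ->]] := ell0_attained v zhat gamma eps 0;
    by rewrite dot0r => h; rewrite ?mulr0 in h; lra.
- rewrite jE zE zhat_origin dist2x0 v_unit/=.
  have [[l ->]|[i ->]] := ell0_attained v zhat gamma eps (v k) => h.
    by have := dot_le_norm2 (v l) (v k); rewrite !v_unit => h1; lra.
  have := dot_le_norm2 (zhat i) (v k); rewrite !v_unit => h1.
  have h2 := zhat_ball i; have h3 := norm2_ge0 (zhat i); nra.
- rewrite j0 zE dist2xx.
  have [[l ->]|[i ->]] := ell0_attained v zhat gamma eps (zhat j) => h.
    by have := max_corr_ge v zhat j l j0; rewrite dotC => h1; lra.
  have := dot_le_norm2 (zhat i) (zhat j); rewrite (zhat_unit j j0) => h1.
  have h2 := zhat_ball i; have h3 := norm2_ge0 (zhat i); nra.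
Qed.

(** The sample piece of the origin vanishes at [x = 0]. *)
Lemma phi_ge0 z : 0 <= phi z.
Proof.
have := ell0_ge_sample v zhat gamma eps origin z.
by rewrite zhat_origin dotC dot0r mulr0.
Qed.

Lemma phi_v k : phi (v k) = 1 - eps.
Proof.
apply/eqP; rewrite eq_le; apply/andP; split.
  have := phi_le (v k) origin; rewrite v_unit zhat_origin dist2x0 v_unit /psi/=.
  by move=> /(_ (lexx _)); lra.
by have := ell0_ge_simplex v zhat gamma eps k (v k); rewrite -norm2_sqr v_unit expr1n.
Qed.

Lemma phi_zhat i : phi (zhat i) = psi i.
Proof.
apply/eqP; rewrite eq_le; apply/andP; split.
  by have := phi_le (zhat i) i (zhat_ball i); rewrite dist2xx mulr0 add0r.
rewrite /psi; case: ifPn => i0; last exact: phi_ge0.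
have := ell0_ge_sample v zhat gamma eps i (zhat i).
by rewrite -norm2_sqr zhat_unit// expr1n mulr1.
Qed.

(** * [Qdual] as a weighted sum over the points [pt] *)

Local Notation E := (borelRn R n).
Local Notation rho := (1 / (2 * N%:R) : R).
Local Notation Bnd := ((1 - eps) * rho + N%:R^-1 * \sum_i psi i).
Local Notation ambig := (ambiguity_set unit_ball dist2 (empirical hN zhat) rho).

Lemma zhat_inj : injective zhat.
Proof. by move=> i j ij; have [] := pt_inj (inr i) (inr j) ij. Qed.

Lemma pt_ball t : norm2 (pt t) <= 1.
Proof. by case: t => [k|i] /=; [rewrite v_unit|exact: zhat_ball]. Qed.

Lemma pt_meas t : measurable ([set pt t] : set E).
Proof. exact: set1_borel. Qed.

Lemma sum_samples (V : zmodType) (F : 'I_N -> V) :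
  \sum_i F i = F origin + \sum_(i < N | (0 < i)%N) F i.
Proof.
by rewrite (bigD1 origin)//=; congr (_ + _); apply: eq_bigl => i; rewrite neq_origin.
Qed.

(** Masses of [Qdual] at the points [pt]; the origin keeps half of its [1 / N]. *)
Definition wt (t : 'I_n.+1 + 'I_N) : R :=
  match t with
  | inl _ => N%:R^-1 * (2 * n.+1%:R)^-1
  | inr i => N%:R^-1 * (if (0 < i)%N then 1 else 2^-1)
  end.

Lemma wt_gt0 t : 0 < wt t.
Proof.
have N0 : 0 < N%:R :> R by rewrite ltr0n; apply: leq_trans hN.
by case: t => [k|i] /=; rewrite mulr_gt0 ?invr_gt0//; case: ifP.
Qed.

Lemma QdualE (A : set E) : Qdual hN v zhat A = (\sum_t wt t * \1_A (pt t))%:E.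
Proof.
rewrite big_sumType/= -!mulr_sumr.
rewrite [X in _ + X](sum_samples _
  (fun i => N%:R^-1 * (if (0 < i)%N then 1 else 2^-1) * \1_A (zhat i)))/=.
rewrite zhat_origin /Qdual.
rewrite /dirac !sumEFin -!EFinM -!EFinD; congr EFin.
under [X in _ = _ + (_ + X)]eq_bigr => i i0 do rewrite i0 mulr1.
rewrite -mulr_sumr; ring.
Qed.

Lemma Qdual_set1 t : Qdual hN v zhat [set pt t] = (wt t)%:E.
Proof.
rewrite QdualE (bigD1 t)//= indicE mem_set// mulr1 big1 ?addr0// => u ut.
by rewrite indicE memNset ?mulr0//= => /pt_inj/eqP; exact/negP.
Qed.

Lemma Qdual_eq1 (A : set E) : (forall t, A (pt t)) -> Qdual hN v zhat A = 1%E.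
Proof.
move=> At; transitivity (Qdual hN v zhat setT); last exact: probability_setT.
by rewrite !QdualE; congr EFin; apply: eq_bigr => t _; rewrite !indicE !mem_set.
Qed.

Lemma Qdual_range : Qdual hN v zhat (range pt) = 1%E.
Proof. by apply: Qdual_eq1 => t; exists t. Qed.

(** * Measures concentrated on the points [pt] *)

Section mass.
Variable Q : probability E R.
Hypothesis Q_range : Q (range pt) = 1%E.
Local Notation q t := (fine (Q [set pt t])).

Lemma integral_pt (f : E -> R) : measurable_fun setT f ->
  (\int[Q]_z (f z)%:E = (\sum_t f (pt t) * q t)%:E)%E.
Proof.
apply: (@integral_concentrated _ _ E _ _ pt) => //; first exact: pt_inj.
exact: pt_meas.
Qed.

Lemma sum_mass : \sum_t q t = 1.
Proof.
have : (\int[Q]_z (cst 1 z : R)%:E = 1)%E.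
  rewrite (@integral_cst _ _ _ Q setT measurableT 1%E) mul1e.
  exact: probability_setT.
rewrite integral_pt// => -[<-].
by apply: eq_bigr => t _; rewrite mul1r.
Qed.

(** By [ellE], such a measure enters only through its mean and its average of [phi]. *)
Lemma expectation_ell x : ('E_Q[ell v zhat gamma eps x] =
  (norm2 x ^+ 2 - 2 * dot x (\sum_t q t *: pt t)
   + \sum_t phi (pt t) * q t)%:E)%E.
Proof.
rewrite unlock integral_pt; last exact: measurable_ell.
congr EFin; under eq_bigr do rewrite ellE mulrDl mulrBl.
rewrite big_split/= sumrB -mulr_sumr sum_mass mulr1.
congr (_ - _ + _); rewrite dot_sumr mulr_sumr; apply: eq_bigr => t _.
by rewrite dotZr mulrAC -mulrA.
Qed.

Lemma mass_measure (A : set E) : measurable A ->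
  Q A = (\sum_t q t * \1_A (pt t))%:E.
Proof.
move=> mA; rewrite -[in LHS](setIT A) -integral_indic// integral_pt.
  by congr EFin; apply: eq_bigr => t _; rewrite mulrC.
exact: measurable_indic.
Qed.

End mass.

(** * Value and feasibility of [Qdual] *)

Lemma wt_sum_simplex : \sum_(k < n.+1) wt (inl k) = rho.
Proof.
rewrite /= sumr_const card_ord -[LHS]mulr_natr.
have : N%:R != 0 :> R by exact: N_neq0.
have : n.+1%:R != 0 :> R by rewrite pnatr_eq0.
by move: (n.+1%:R : R) (N%:R : R) => a b a0 b0; field; rewrite a0 b0.
Qed.

(** The vertices carry mass [rho] at height [1 - eps]; the half mass missing at the origin costs
    nothing, as [psi] is zero there. *)
Lemma wt_phi : \sum_t phi (pt t) * wt t = Bnd.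
Proof.
rewrite big_sumType/= -wt_sum_simplex mulr_sumr; congr (_ + _).
  by apply: eq_bigr => k _; rewrite phi_v.
rewrite mulr_sumr; apply: eq_bigr => i _; rewrite phi_zhat /psi.
by case: ifP => _; ring.
Qed.

Lemma wt_mean : \sum_t wt t *: pt t = 0.
Proof.
rewrite big_sumType/= -scaler_sumr v_centered scaler0 add0r.
rewrite sum_samples zhat_origin scaler0 add0r.
under eq_bigr => i i0 do rewrite i0 mulr1.
by rewrite -scaler_sumr zhat_sum scaler0.
Qed.

Lemma expectation_ell_Qdual x :
  ('E_(Qdual hN v zhat)[ell v zhat gamma eps x] = (norm2 x ^+ 2 + Bnd)%:E)%E.
Proof.
rewrite expectation_ell; last exact: Qdual_range.
have wE t : fine (Qdual hN v zhat [set pt t]) = wt t by rewrite Qdual_set1.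
under eq_bigr do rewrite [fine _]wE.
under [X in _ + X]eq_bigr do rewrite [fine _]wE.
by rewrite wt_mean dot0r mulr0 subr0 wt_phi.
Qed.

Lemma dual_objective_Qdual :
  (Bnd%:E <= dual_objective unit_ball (ell v zhat gamma eps) (Qdual hN v zhat))%E.
Proof.
apply/ereal_infP => _ [x _ <-]; rewrite expectation_ell_Qdual lee_fin.
by rewrite lerDr sqr_ge0.
Qed.

(* The transport map from [Qdual] to the empirical measure. *)
Definition collapse (z : E) : E := if z \in range v then 0 else z.

Lemma collapse_v k : collapse (v k) = 0.
Proof. by rewrite /collapse mem_set//; exists k. Qed.

Lemma collapse_zhat i : collapse (zhat i) = zhat i.
Proof.
by rewrite /collapse memNset// => -[k _ /(pt_inj (inl k) (inr i))].
Qed.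

Lemma measurable_collapse : measurable_fun setT collapse.
Proof.
apply: measurable_fun_ifT => //.
apply: measurable_fun_bool; rewrite setTI (_ : _ @^-1` _ = range v).
  by apply: fin_range_measurable => k; exact: set1_borel.
by apply/seteqP; split=> z /= => [/set_mem|/mem_set].
Qed.

(** Pushing [Qdual] forward along this graph gives the coupling induced by [collapse]. *)
Definition graph_collapse (z : E) : (E * E)%type := (z, collapse z).

Lemma measurable_graph_collapse : measurable_fun setT graph_collapse.
Proof. by apply: measurable_fun_pair => //; exact: measurable_collapse. Qed.

HB.instance Definition _ := @isMeasurableFun.Build _ _ E (E * E)%type
  graph_collapse measurable_graph_collapse.

Lemma Qdual_coupling : coupling (Qdual hN v zhat) (empirical hN zhat)
  (distribution (Qdual hN v zhat) graph_collapse).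
Proof.
split => A mA; rewrite /distribution /pushforward.
  by congr (Qdual hN v zhat _); apply/seteqP; split => z //= [].
rewrite [LHS]QdualE big_sumType/=.
have -> : empirical hN zhat A = (N%:R^-1 * \sum_i \1_A (zhat i))%:E.
  by rewrite EFinM -sumEFin.
congr EFin.
have vE k : \1_(graph_collapse @^-1` (setT `*` A)) (v k : E) = \1_A (0 : E) :> R.
  rewrite !indicE; congr (nat_of_bool _)%:R; apply/idP/idP => /set_mem h; apply/mem_set.
    by move: h => -[_] /=; rewrite collapse_v.
  by split => //=; rewrite collapse_v.
have zE i : \1_(graph_collapse @^-1` (setT `*` A)) (zhat i : E) = \1_A (zhat i : E) :> R.
  rewrite !indicE; congr (nat_of_bool _)%:R; apply/idP/idP => /set_mem h; apply/mem_set.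
    by move: h => -[_] /=; rewrite collapse_zhat.
  by split => //=; rewrite collapse_zhat.
under eq_bigr do rewrite vE.
under [X in _ + X]eq_bigr do rewrite zE.
rewrite -mulr_suml -[X in X * _]/(\sum_(k < n.+1) wt (inl k)) wt_sum_simplex.
(* The mass [rho] collected from the vertices completes the half mass at the origin to [1 / N]. *)
rewrite !sum_samples/= zhat_origin mulrDr mulr_sumr addrA; congr (_ + _).
  by rewrite -mulrDl; congr (_ * _); field; exact: N_neq0.
by apply: eq_bigr => i ->; rewrite mulr1.
Qed.

Lemma Qdual_ambig : ambig (Qdual hN v zhat).
Proof.
split; first by apply: Qdual_eq1 => t; exact: pt_ball.
apply: ge_ereal_inf; eexists.
  by exists (distribution (Qdual hN v zhat) graph_collapse) => //;
    exact: Qdual_coupling.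
rewrite unlock ge0_integral_pushforward//; last 2 first.
- by apply/measurable_EFinP; exact: measurable_fun_dist2.
- by move=> p _; rewrite lee_fin dist2_ge0.
rewrite preimage_setT [leLHS](integral_pt _ Qdual_range (fun z => dist2 z (collapse z))).
  have wE t : fine (Qdual hN v zhat [set pt t]) = wt t by rewrite Qdual_set1.
  under eq_bigr do rewrite [fine _]wE.
  (* Only the vertices move, each over distance 1, so the cost is their total mass [rho]. *)
  rewrite lee_fin big_sumType/= -wt_sum_simplex.
  rewrite [X in _ + X]big1 ?addr0; last first.
    by move=> i _; rewrite collapse_zhat dist2xx mul0r.
  by apply: ler_sum => k _; rewrite collapse_v dist2x0 v_unit mul1r.
by apply: measurable_fun_dist2 => //; exact: measurable_collapse.
Qed.

Lemma slope_ge0 : 0 <= 1 - eps.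
Proof. by have [e1 _] := eps_ltP; have g0 := gamma_gt0; lra. Qed.

Lemma psi_ge0 i : 0 <= psi i.
Proof. by rewrite /psi; case: ifP => // _; exact/ltW/gamma_gt0. Qed.

(** Test with [x = 0], then apply weak duality to the potentials [phi] and [psi]. *)
Lemma dual_objective_le Q : ambig Q ->
  (dual_objective unit_ball (ell v zhat gamma eps) Q <= Bnd%:E)%E.
Proof.
move=> [Qball OTle]; apply: ge_ereal_inf; exists ('E_Q[phi])%E.
  by exists 0 => //; rewrite /unit_ball/= norm2_0.
rewrite unlock; apply: (weak_duality hN zhat zhat_inj Q unit_ball) => //.
- exact: unit_ball_borel.
- exact: slope_ge0.
- exact: psi_ge0.
- exact: measurable_ell.
- exact: phi_ge0.
- by move=> z i z1; exact: phi_le.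
Qed.

Lemma least_favorable_Qdual :
  least_favorable unit_ball (ell v zhat gamma eps) ambig (Qdual hN v zhat).
Proof.
split; first exact: Qdual_ambig.
move=> Q QP; apply: le_trans dual_objective_Qdual.
exact: dual_objective_le.
Qed.

(** * Consequences of optimality *)

Section optimal.
Variable Q : probability E R.
Hypothesis LFQ : least_favorable unit_ball (ell v zhat gamma eps) ambig Q.
Local Notation q t := (fine (Q [set pt t])).

Lemma optimal_ge x : norm2 x <= 1 -> (Bnd%:E <= 'E_Q[ell v zhat gamma eps x])%E.
Proof.
move=> x1; apply: (le_trans dual_objective_Qdual).
apply: (le_trans (LFQ.2 _ Qdual_ambig)).
by apply: ge_ereal_inf; exists ('E_Q[ell v zhat gamma eps x])%E => //; exists x.
Qed.

(** Any potentials feasible on a set of full [Q]-mass may be tried: below, [phi] itself, a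
    c-transform, and perturbations at a sample. *)
Lemma optimal_duality (S : set E) (psi' : 'I_N -> R) (f : E -> R) :
  measurable S -> Q S = 1%E -> (forall i, 0 <= psi' i) ->
  measurable_fun setT f -> (forall z, 0 <= f z) ->
  (forall z i, S z -> f z <= (1 - eps) * dist2 z (zhat i) + psi' i) ->
  (\int[Q]_z (f z)%:E <= ((1 - eps) * rho + N%:R^-1 * \sum_i psi' i)%:E)%E.
Proof.
move=> mS QS p0 mf f0 fle.
apply: (weak_duality hN zhat zhat_inj Q S) => //; first exact: slope_ge0.
exact: LFQ.1.2.
Qed.

(** Duality bounds the integral above; below, a maximizer does at least as well as [Qdual], and
    [x = 0] is admissible. *)
Lemma optimal_phi : (\int[Q]_z (phi z)%:E = Bnd%:E)%E.
Proof.
apply/eqP; rewrite eq_le; apply/andP; split.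
  apply: (optimal_duality unit_ball) => //.
  - exact: unit_ball_borel.
  - exact: LFQ.1.1.
  - exact: psi_ge0.
  - exact: measurable_ell.
  - exact: phi_ge0.
  - by move=> z i z1; exact: phi_le.
by have := optimal_ge 0; rewrite norm2_0 expectation.unlock => /(_ ler01).
Qed.

(* The c-transform of [psi] is another feasible dual potential, so it has the
   same integral as [phi]; it exceeds [phi] off the atoms. *)
Lemma optimal_concentrated : Q (range pt) = 1%E.
Proof.
pose G i (z : E) := (1 - eps) * dist2 z (zhat i) + psi i.
(* The maximum with [phi] ensures [phi <= F] outside the ball as well; inside, [F] is the
   c-transform. The default [G origin] is itself a member of the family. *)
pose F (z : E) := Num.max (phi z) (\big[Num.min/G origin z]_i G i z).
have mphi : measurable_fun setT (phi : E -> R) by exact: measurable_ell.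
have mG i : measurable_fun setT (G i).
  apply: measurable_funD => //; apply: measurable_funM => //.
  exact: measurable_fun_dist2.
have mF : measurable_fun setT F.
  by apply: measurable_maxr => //; exact: measurable_fun_bigmin.
have phiF z : phi z <= F z by rewrite /F le_max lexx.
have FB : (\int[Q]_z (F z)%:E <= Bnd%:E)%E.
  apply: (optimal_duality unit_ball) => //.
  - exact: unit_ball_borel.
  - exact: LFQ.1.1.
  - exact: psi_ge0.
  - by move=> z; apply: le_trans (phiF z); exact: phi_ge0.
  - move=> z i z1; rewrite /F ge_max phi_le//=.
    exact: (bigmin_le _ _ (fun i => G i z)).
have mD : measurable_fun setT (fun z => F z - phi z) by exact: measurable_funB.
(* [F] lies above [phi] but its integral does not exceed that of [phi]. *)
have D0 : (\int[Q]_z `|(F z - phi z)%:E| = 0)%E.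
  have dE : (\int[Q]_z (F z)%:E =
      \int[Q]_z (phi z)%:E + \int[Q]_z `|(F z - phi z)%:E|)%E.
    rewrite -ge0_integralD//.
    - apply: eq_integral => z _; rewrite -EFinD ger0_norm ?subr_ge0//.
      by rewrite subrKC.
    - by move=> z _; rewrite lee_fin phi_ge0.
    - exact/measurable_EFinP.
    - by apply: measurableT_comp => //; exact/measurable_EFinP.
  apply/eqP; rewrite eq_le integral_ge0// andbT.
  by move: FB; rewrite dE optimal_phi -{2}[Bnd%:E]adde0 leeD2lE.
have [A [mA QA AD]] : ae_eq Q setT (fun z => (F z - phi z)%:E) (cst 0%E).
  by apply/ae_eq_integral_abs => //; exact/measurable_EFinP.
have mball := @unit_ball_borel R n.
have mpt : measurable (range pt : set E).
  by apply: fin_range_measurable; exact: pt_meas.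
(* In the ball and off the null set, [F z = phi z], so some [G i z <= phi z] and [tight] locates
   [z]. *)
have sub : ~` range pt `<=` A `|` ~` unit_ball.
  move=> z ptz; apply: contrapT => /not_orP[Az /contrapT z1].
  apply: Az; apply: AD => /= /(_ I)[] /eqP; rewrite subr_eq0 => /eqP Fphi.
  have : F z <= phi z by rewrite Fphi.
  rewrite /F ge_max lexx/= => /bigmin_leP h.
  have [i Gi] : exists i, G i z <= phi z.
    by case: h => [h|[i _ h]]; [exists origin|exists i].
  apply: ptz.
  have [[_ [->|[k ->]]]|[_ ->]] := tight z i z1 Gi.
  - by exists (inr origin) => //=; rewrite zhat_origin.
  - by exists (inl k).
  - by exists (inr i).
have : Q (~` range pt) = 0%E.
  apply/eqP; rewrite eq_le measure_ge0 andbT.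
  apply: (@le_trans _ _ (Q (A `|` ~` unit_ball))).
    apply: le_measure => //; rewrite inE; first exact: measurableC.
    by apply: measurableU => //; exact: measurableC.
  apply: (le_trans (measureU2 _ _ _)) => //; first exact: measurableC.
  rewrite [X in (X + _)%E]QA add0e.
  by rewrite [leLHS](probability1_setC Q _ mball LFQ.1.1).
rewrite probability_setC// => Q0.
have : Q (range pt) \is a fin_num by rewrite fin_num_measure.
by move: Q0; case: (Q (range pt)) => // r [] /eqP; rewrite subr_eq0 => /eqP <-.
Qed.

(* Perturbing both [phi] and [psi] at one sample, with either sign, stays
   feasible on the atoms because all other pairs have positive slack. *)
Lemma optimal_sample (i : 'I_N) : (0 < i)%N -> q (inr i) = N%:R^-1.
Proof.
move=> i0; have Qr := optimal_concentrated.
pose slack (p : ('I_n.+1 + 'I_N) * 'I_N) :=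
  (1 - eps) * dist2 (pt p.1) (zhat p.2) + psi p.2 - phi (pt p.1).
(* [a <= gamma] keeps the perturbed potentials nonnegative. Only pairs where exactly one potential
   moves restrict [a]; for sample [i] paired with itself both move together. *)
have [a /andP[a0 ag] alb] : exists2 a, 0 < a <= gamma &
    forall p, (p.1 == inr i) != (p.2 == i) -> a <= slack p.
  apply: finite_gt0_lb; first exact: gamma_gt0.
  move=> [t j] /= tj; rewrite subr_gt0 ltNge; apply/negP => h; move/negP: tj; apply.
  have [[jE ptE]|[j0 ptE]] := tight (pt t) j (pt_ball t) h.
    have -> : (j == i) = false.
      by apply/negbTE; rewrite jE eq_sym neq_origin.
    apply/eqP/negbTE/eqP => tE; move: ptE; rewrite tE /= => -[zi|[k]].
      move: (zhat_inj i origin); rewrite zi zhat_origin => /(_ erefl) iE.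
      by move: i0; rewrite iE.
    by move=> /(pt_inj (inr i) (inl k)).
  have -> : t = inr j by apply: pt_inj.
  by apply/eqP; apply/eqP/eqP => [[->]|->].
have key s : `|s| <= a -> s * q (inr i) <= s * N%:R^-1.
  move=> /ler_normlP[s1 s2].
  pose f (z : E) := phi z + s * \1_[set zhat i] z.
  have fz z : f z = phi z + s * (z == zhat i)%:R.
    rewrite /f indicE; congr (_ + s * (nat_of_bool _)%:R).
    by apply/idP/eqP => [/set_mem//|->]; apply/mem_set.
  have mf : measurable_fun setT f.
    apply: measurable_funD; first exact: measurable_ell.
    apply: measurable_funM => //; apply: measurable_indic; exact: set1_borel.
  have := optimal_duality (range pt) (fun j => psi j + s * (j == i)%:R) f.
  rewrite (integral_pt _ Qr)// lee_fin big_split/= -mulr_sumr.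
  have -> : \sum_(j < N) (j == i)%:R = 1 :> R.
    by rewrite (bigD1 i)//= eqxx big1 ?addr0// => j /negbTE ->.
  have -> : \sum_t f (pt t) * q t = Bnd + s * q (inr i).
    have := optimal_phi; rewrite (integral_pt _ Qr) => [[<-]|]; last exact: measurable_ell.
    transitivity (\sum_t (phi (pt t) * q t + s * (pt t == zhat i)%:R * q t)).
      by apply: eq_bigr => t _; rewrite fz mulrDl.
    rewrite big_split/=; congr (_ + _).
    rewrite (bigD1 (inr i))//= eqxx mulr1 big1 ?addr0// => t ti.
    rewrite (_ : (pt t == zhat i) = false) ?mulr0 ?mul0r//.
    by apply/negbTE; apply: contra ti => /eqP/(pt_inj t (inr i))/eqP.
  move=> main; suff : Bnd + s * q (inr i) <= (1 - eps) * rho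
      + N%:R^-1 * (\sum_j psi j + s * 1) by lra.
  apply: main => //.
  - by apply: fin_range_measurable; exact: pt_meas.
  - move=> j; have [->|] := eqVneq j i; last by rewrite mulr0 addr0 psi_ge0.
    by rewrite mulr1 /psi i0; lra.
  - move=> z; rewrite fz; have [->|] := eqVneq z (zhat i); last first.
      by rewrite mulr0 addr0 phi_ge0.
    by rewrite mulr1 phi_zhat /psi i0; lra.
  - move=> _ j [t _ <-]; rewrite fz.
    have h0 := phi_le (pt t) j (pt_ball t).
    have -> : (pt t == zhat i) = (t == inr i).
      by apply/eqP/eqP => [/(pt_inj t (inr i))|->].
    have := alb (t, j); rewrite /slack/=.
    by case: (t == inr i); case: (j == i) => /=; do ?[move=> /(_ isT)]; lra.
(* The values [s = a] and [s = - a] give the two inequalities. *)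
have na : `|a| <= a by rewrite ger0_norm// ltW.
have := key a na; rewrite ler_pM2l// => h1.
have := key (- a); rewrite normrN => /(_ na).
rewrite !mulNr lerN2 ler_pM2l// => h2.
by apply/eqP; rewrite eq_le h1 h2.
Qed.

(** Every other term of the optimal value is known: the boundary masses are fixed and [phi] vanishes
    at the origin. Then divide by [1 - eps]. *)
Lemma optimal_simplex_sum : \sum_k q (inl k) = rho.
Proof.
have := optimal_phi; rewrite (integral_pt _ optimal_concentrated).
  move=> [] /=; rewrite big_sumType/=.
  under eq_bigr do rewrite phi_v.
  rewrite -mulr_sumr => h.
  have c0 : 1 - eps != 0.
    by have [e1 _] := eps_ltP; have g0 := gamma_gt0; apply: lt0r_neq0; lra.
  apply: (mulfI c0); apply: (addIr (N%:R^-1 * \sum_i psi i)); rewrite -h.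
  congr (_ + _); rewrite mulr_sumr; apply: eq_bigr => i _; rewrite phi_zhat.
  have [i0|] := boolP (0 < i)%N; first by rewrite [q (inr i)]optimal_sample// mulrC.
  by move=> /negbTE i0; rewrite /psi i0 mulr0 mul0r.
exact: measurable_ell.
Qed.

(** Otherwise moving [x] from 0 towards the mean would push the expected loss below [Bnd]. *)
Lemma optimal_mean : \sum_t q t *: pt t = 0.
Proof.
set m := \sum_t _; apply: norm2_eq0.
set a := norm2 m; have a0 : 0 <= a := norm2_ge0 m.
(* The factor [s = 1 / (1 + a)] brings [m] into the ball; the expected loss changes by
   [s * a^2 * (s - 2)], negative unless [a = 0] since [s <= 1]. *)
have s0 : 0 < (1 + a)^-1 by rewrite invr_gt0 ltr_pwDl.
have sm : norm2 ((1 + a)^-1 *: m) = (1 + a)^-1 * a by rewrite norm2Z// ltW.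
have := optimal_ge ((1 + a)^-1 *: m).
rewrite (expectation_ell _ optimal_concentrated) -/m sm lee_fin.
have := optimal_phi; rewrite (integral_pt _ optimal_concentrated); last first.
  exact: measurable_ell.
move=> [->]; rewrite dotC dotZr -norm2_sqr -/a => h2.
have h1 : (1 + a)^-1 * a <= 1.
  by rewrite mulrC ler_pdivrMr ?ltr_pwDl// mul1r lerDr.
move: h2 => /(_ h1) h2.
have h3 : 0 <= (1 + a)^-1 * (a ^+ 2 * ((1 + a)^-1 - 2)) by lra.
rewrite pmulr_rge0// in h3.
have h4 : (1 + a)^-1 <= 1 by rewrite invf_le1 ?lerDl// ltr_pwDl.
have h5 : a ^+ 2 = 0 by have := sqr_ge0 a; nra.
by move/eqP: h5; rewrite sqrf_eq0 => /eqP.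
Qed.

Lemma optimal_mass t : q t = wt t.
Proof.
have := sum_mass _ optimal_concentrated.
have mean := optimal_mean.
rewrite big_sumType/= optimal_simplex_sum sum_samples.
under eq_bigr => i i0 do rewrite [fine _](optimal_sample i i0).
have N1 : N%:R^-1 + \sum_(i < N | (0 < i)%N) N%:R^-1 = 1 :> R.
  rewrite -(sum_samples _ (fun=> N%:R^-1)) sumr_const card_ord -[LHS]mulr_natr.
  by rewrite mulVf//; exact: N_neq0.
move=> tot.
(* The origin gets what is left after [rho] on the simplex and [1 / N] on each boundary sample. *)
have q0 : q (inr origin) = N%:R^-1 * 2^-1.
  have : rho = N%:R^-1 * 2^-1 by field; exact: N_neq0.
  have h2 : N%:R^-1 = N%:R^-1 * 2^-1 + N%:R^-1 * 2^-1 :> R by field; exact: N_neq0.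
  move=> h1; move: tot N1 => /=; lra.
case: t => [k|i] /=; last first.
  have [->//|] := eqVneq i origin.
  by rewrite neq_origin => i0; rewrite i0 mulr1 [LHS](optimal_sample i i0).
apply/eqP; rewrite -subr_eq0; apply/eqP.
(* On the vertices, [q] and [wt] have the same sum and both weighted sums vanish, so their
   difference is an affine relation. *)
apply: (v_affine (fun k => q (inl k) - wt (inl k))).
  by rewrite sumrB optimal_simplex_sum wt_sum_simplex subrr.
under eq_bigr do rewrite scalerBl.
rewrite sumrB -[X in _ - X]scaler_sumr v_centered scaler0 subr0.
move: mean; rewrite big_sumType/= [X in _ + X]sum_samples/= zhat_origin scaler0 add0r.
under [X in _ + X]eq_bigr => i i0 do rewrite [fine _](optimal_sample i i0).
by rewrite -scaler_sumr zhat_sum scaler0 addr0.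
Qed.

Lemma optimal_unique (A : set E) : measurable A -> Q A = Qdual hN v zhat A.
Proof.
move=> mA; rewrite (mass_measure _ optimal_concentrated)// QdualE.
by congr EFin; apply: eq_bigr => t _; rewrite optimal_mass.
Qed.

End optimal.

(** * Counting the atoms *)

Lemma card_range_pt : (range pt #= `I_(N + n + 1))%card.
Proof.
have -> : (N + n + 1 = n.+1 + N)%N by rewrite addn1 -addnS addnC.
have -> : range pt = range (pt \o @fintype.split n.+1 N).
  apply/seteqP; split => [_ [t _ <-]|_ [i _ <-]]; last by exists (fintype.split i).
  by exists (unsplit t) => //=; rewrite unsplitK.
apply: card_eq_trans (card_esym card_II); apply: inj_card_eq => i j _ _.
by move=> /pt_inj/(can_inj (@splitK _ _)).
Qed.

(** The range is finite, hence closed, its complement is null, and each of its points has positive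
    mass. *)
Lemma supp_Qdual : supp (Qdual hN v zhat) = range pt.
Proof.
apply/seteqP; split => [z zs|_ [t _ <-] U oU Ut].
  apply: contrapT => zpt.
  have cpt : closed (range pt).
    by apply: finite_set_closed_rV; apply: finite_image; exact: finite_finset.
  have := zs _ (closed_openC cpt) zpt.
  rewrite (@probability1_setC _ _ _ (Qdual hN v zhat)) ?ltxx//.
    by apply: (@fin_range_measurable _ E); exact: pt_meas.
  exact: Qdual_range.
rewrite [ltRHS]QdualE lte_fin (bigD1 t)//= indicE mem_set// mulr1 ltr_pwDl ?wt_gt0//.
by apply: sumr_ge0 => u _; rewrite mulr_ge0// ltW// wt_gt0.
Qed.

(** By uniqueness [Q] agrees with [Qdual] on Borel sets, hence has the same support and the same
    point masses. *)
Lemma least_favorable_atoms Q :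
  least_favorable unit_ball (ell v zhat gamma eps) ambig Q ->
  (`I_(N + n + 1) #<= supp Q `&` atoms Q)%card.
Proof.
move=> LFQ; rewrite -(card_le_eql card_range_pt); apply: subset_card_le => z ptz.
split; first by rewrite (supp_eq _ _ (optimal_unique Q LFQ)) supp_Qdual.
move: ptz => [t _ <-]; rewrite /atoms/= [ltRHS](optimal_unique Q LFQ); last first.
  exact: pt_meas.
by rewrite Qdual_set1 lte_fin wt_gt0.
Qed.

End instance.

Theorem lemma14 (R : realType) (n N : nat) (hN : (3 <= N)%N)
    (zhat : 'I_N -> 'rV[R]_n)
    (zhat_first : forall i : 'I_N, i = 0%N :> nat -> zhat i = 0)
    (zhat_distinct : forall i j : 'I_N, (0 < i)%N -> (0 < j)%N ->
       zhat i = zhat j -> i = j)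
    (zhat_unit : forall i : 'I_N, (0 < i)%N -> norm2 (zhat i) = 1)
    (zhat_sum : \sum_(i < N | (0 < i)%N) zhat i = 0)
    (v : 'I_n.+1 -> 'rV[R]_n)
    (v_regular : regular_simplex v)
    (v_centered : centered v)
    (v_unit : forall k, norm2 (v k) = 1)
    (M_lt1 : max_corr v zhat < 1)
    (gamma eps : R)
    (gamma_gt : max_corr v zhat < gamma) (gamma_lt1 : gamma < 1)
    (eps_gt0 : 0 < eps)
    (eps_lt : eps < Num.min (1 - gamma) (gamma - max_corr v zhat)) :
  let rho : R := 1 / (2 * N%:R) in
  let P : set (probability (borelRn R n) R) :=
    ambiguity_set unit_ball dist2 (empirical hN zhat) rho in
  let LF : set (probability (borelRn R n) R) :=
    least_favorable unit_ball (ell v zhat gamma eps) P in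
  let Qstar : probability (borelRn R n) R := Qdual hN v zhat in
  (forall Q, LF Q -> (`I_(N + n + 1) #<= supp Q `&` atoms Q)%card) /\
  [/\ LF Qstar,
      (supp Qstar #= `I_(N + n + 1))%card &
      forall Q, LF Q -> (supp Q #= `I_(N + n + 1))%card ->
        forall A : set (borelRn R n), measurable A -> Q A = Qstar A].
Proof.
move=> rho P LF Qstar; have [v_affine _] := v_regular.
split=> [Q LFQ|].
  exact: (@least_favorable_atoms R n N hN zhat zhat_first zhat_distinct
    zhat_unit zhat_sum v v_affine v_centered v_unit M_lt1 gamma eps).
split.
- exact: least_favorable_Qdual.
- rewrite supp_Qdual//.
  exact: card_range_pt.
- move=> Q LFQ _ A mA.
  exact: (@optimal_unique R n N hN zhat zhat_first zhat_distinct
    zhat_unit zhat_sum v v_affine v_centered v_unit M_lt1 gamma eps).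
Qed.
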